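(* Let $\pi=(\pi^n)_{n\in\mathbb{N}}$ be a sequence such that $\pi^n_i\ge 0$, $\sum_{i=0}^n\pi^n_i=1$, and $\pi^n_i=0$ for $i>n$. Then there exist a non-expansive map $T:C\to C$ (on some bounded convex subset $C$ of a normed space $(X,\|\cdot\|)$, with $\operatorname{diam}(C)=1$) and a corresponding Mann sequence $(x^n)_{n\in\mathbb{N}}$ for which all the bounds $\|x^m-x^n\|\le d_{m,n}$ and $\|x^n-Tx^n\|\le R_n$ are attained with equality, that is, $$\|x^m-x^n\|=d_{m,n}(\pi)\quad\text{for all } m,n\in\mathbb{N},\qquad \|x^n-Tx^n\|=R_n(\pi)\quad\text{for all } n\in\mathbb{N}.$$ In particular $\Psi_n(\pi)=R_n(\pi)$ for all $n\in\mathbb{N}$.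
   Context: Here $\mathbb{N}=\{0,1,2,\ldots\}$. A map $T:C\to C$, where $C$ is a bounded convex subset of a normed space $(X,\|\cdot\|)$, is non-expansive if $\|Tx-Ty\|\le\|x-y\|$ for all $x,y\in C$. The norm is normalized so that $\operatorname{diam}(C)=1$. Mann sequences. Given $\pi$, a non-expansive map $T:C\to C$, and a pair of initial points $x^0,y^0\in C$ (both choices $x^0=y^0$ and $x^0\ne y^0$ are allowed), adopt the convention $Tx^{-1}=y^0$ (a notation only). The Mann sequence is defined recursively by $$x^n=\sum_{i=0}^n\pi^n_i\,Tx^{i-1}\qquad\text{for all } n\ge 1.$$ Bounds. Define real numbers $d_{m,n}=d_{m,n}(\pi)$ for integers $m,n\ge -1$ by $d_{-1,-1}=0$, $d_{-1,j}=d_{j,-1}=1$ for all $j\in\mathbb{N}$, and recursively for $m,n\in\mathbb{N}$ $$d_{m,n}=\min_{z\in\mathcal{F}(\pi^m,\pi^n)}\ \sum_{i=0}^m\sum_{j=0}^n z_{i,j}\,d_{i-1,j-1},$$ where $\mathcal{F}(\pi^m,\pi^n)$ is the set of transport plans taking $\pi^m$ into $\pi^n$, i.e. of all arrays $z=(z_{i,j})_{0\le i\le m,\,0\le j\le n}$ with $z_{i,j}\ge 0$, $\sum_{j=0}^n z_{i,j}=\pi^m_i$ for $i=0,\ldots,m$, and $\sum_{i=0}^m z_{i,j}=\pi^n_j$ for $j=0,\ldots,n$. Further define $$R_n=R_n(\pi)=\sum_{i=0}^n\pi^n_i\,d_{i-1,n}.$$ Worst-case residual. $\Psi_n(\pi)=\sup_{T,x^0,y^0}\|x^n-Tx^n\|$,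 where the supremum is taken over all non-expansive maps $T:C\to C$ with $\operatorname{diam}(C)=1$ ($C$ a bounded convex subset of a normed space), and all possible initial points $x^0,y^0\in C$, with $(x^n)$ the corresponding Mann sequence.
   Formalization: The supremum defining Ψ_n is taken only over equal initial points x^0=y^0; with x^0≠y^0 allowed, Ψ_n=R_n fails (C=[0,1], Tx=1-x, x^0=0, y^0=1, π^1=(1/2,1/2) gives residual 1 > 3/4 = R_1). *)

(* Defs.v *)
From mathcomp Require Export all_boot all_order all_algebra.
From mathcomp Require Export all_classical all_reals all_analysis.
Export Order.TTheory GRing.Theory Num.Theory.
Export numFieldNormedType.Exports.

Set Implicit Arguments.
Unset Strict Implicit.
Unset Printing Implicit Defensive.

Local Open Scope classical_set_scope.
Local Open Scope ring_scope.

Section OptimalTransport.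
Context {R : realType}.
Implicit Types (p q : nat -> R) (c : nat -> nat -> R) (pi : nat -> nat -> R).

Definition transport_plans (m n : nat) p q : set 'M[R]_(m.+1, n.+1) :=
  [set z | [/\ forall (i : 'I_m.+1) (j : 'I_n.+1), 0 <= z i j,
               forall i : 'I_m.+1, \sum_(j < n.+1) z i j = p i &
               forall j : 'I_n.+1, \sum_(i < m.+1) z i j = q j]].

Definition transport_cost (m n : nat) c (z : 'M[R]_(m.+1, n.+1)) : R :=
  \sum_(i < m.+1) \sum_(j < n.+1) z i j * c i j.

(* The minimum over the transport plans, written as an infimum; it is attained
   as soon as a plan exists, see [min_transport_attained]. *)
Definition min_transport (m n : nat) p q c : R :=
  inf [set transport_cost c z | z in @transport_plans m n p q].

(* [dist_upto pi k r s] computes d_{r-1,s-1} for r <= k: the indices of d are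
   shifted by one, so that they start at 0 instead of -1, and k is the fuel of
   the recursion, see [dS_SS]. *)
Fixpoint dist_upto pi (k r s : nat) : R :=
  match r, s with
  | 0, 0 => 0
  | 0, _.+1 | _.+1, 0 => 1
  | m.+1, n.+1 =>
      if k is k'.+1 then min_transport m n (pi m) (pi n) (dist_upto pi k')
      else 0
  end.

(* [dS pi r s] is d_{r-1,s-1}. *)
Definition dS pi (r s : nat) : R := dist_upto pi r r s.

Definition dbound pi (m n : nat) : R := dS pi m.+1 n.+1.

Definition Rbound pi (n : nat) : R := \sum_(i < n.+1) pi n i * dS pi i n.+1.

Lemma eq_min_transport m n p q c c' :
  (forall i j, (i <= m)%N -> (j <= n)%N -> c i j = c' i j) ->
  min_transport m n p q c = min_transport m n p q c'.
Proof.
move=> cc'; congr (inf _); apply: eq_imagel => z _.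
apply: eq_bigr => i _; apply: eq_bigr => j _.
by rewrite cc' //; [case: i | case: j].
Qed.

Lemma dist_upto_fuel pi k r s : (r <= k)%N -> dist_upto pi k r s = dS pi r s.
Proof.
rewrite /dS; elim/ltn_ind: k r s => -[|k] IH [|m] [|n] // mk.
apply: eq_min_transport => i j im _.
by apply: (etrans (IH k _ i j _) (esym (IH m _ i j _)));
  rewrite // (leq_trans im).
Qed.

Lemma dS_SS pi m n :
  dS pi m.+1 n.+1 = min_transport m n (pi m) (pi n) (dS pi).
Proof. by apply: eq_min_transport => i j im _; exact: dist_upto_fuel. Qed.

Lemma min_transport_attained m n p q c :
  @transport_plans m n p q !=set0 ->
  exists2 z, @transport_plans m n p q z &
    transport_cost c z = min_transport m n p q c.
Proof.
set A := @transport_plans m n p q; move=> A0.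
pose B : set 'rV[R]_(m.+1 * n.+1) := vec_mx @^-1` A.
have cont i j : continuous (fun v : 'rV[R]_(m.+1 * n.+1) => vec_mx v i j).
  have -> : (fun v : 'rV[R]_(m.+1 * n.+1) => vec_mx v i j) =
      fun v : 'rV[R]_(m.+1 * n.+1) => v 0 (mxvec_index i j).
    by apply/funext => v; rewrite mxE.
  exact: coord_continuous.
have pre (f : 'rV[R]_(m.+1 * n.+1) -> R) (D : set R) :
    continuous f -> closed D -> closed (f @^-1` D).
  by move=> fc; apply: preimage_closed => v _; exact: fc.
have sumc k (F : 'I_k -> 'rV[R]_(m.+1 * n.+1) -> R) :
    (forall i, continuous (F i)) -> continuous (fun v => \sum_(i < k) F i v).
  by move=> Fc; apply: continuous_big => //; exact: add_continuous.
have B0 : B !=set0 by case: A0 => z Az; exists (mxvec z); rewrite /B /= mxvecK.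
have Bclosed : closed B.
  have -> : B =
    (\bigcap_(k in [set: 'I_m.+1 * 'I_n.+1]) [set v | 0 <= vec_mx v k.1 k.2])
    `&` (\bigcap_(i in [set: 'I_m.+1])
          [set v | \sum_(j < n.+1) vec_mx v i j = p i])
    `&` (\bigcap_(j in [set: 'I_n.+1])
          [set v | \sum_(i < m.+1) vec_mx v i j = q j]).
    apply/seteqP; split=> v.
      by move=> [h1 h2 h3]; split; [split|] => //= k _; first exact: h1.
    move=> [[h1 h2] h3]; split=> [i j|i|j]; first exact: (h1 (i, j)).
      exact: h2.
    exact: h3.
  apply: closedI; first apply: closedI; apply: closed_bigI => k _.
  - by apply: (pre _ [set x | 0 <= x]); [exact: cont | exact: closed_ge].
  - apply: (pre _ [set x | x = p k]); last exact: closed_eq.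
    by apply: sumc => l; exact: cont.
  - apply: (pre _ [set x | x = q k]); last exact: closed_eq.
    by apply: sumc => l; exact: cont.
have Bcompact : compact B.
  pose M := \sum_(i < m.+1) p i.
  have boxc : compact
      [set v : 'rV[R]_(m.+1 * n.+1) | forall i, v ord0 i \in `[0, M]].
    apply: (@rV_compact _ _ (fun=> `[0, M]%classic)) => _.
    exact: segment_compact.
  apply: subclosed_compact Bclosed boxc _ => v [h1 h2 _] k.
  case/mxvec_indexP: k => i j.
  have -> : v ord0 (mxvec_index i j) = vec_mx v i j by rewrite mxE.
  have p_ge0 (l : 'I_m.+1) : 0 <= p l by rewrite -h2; exact: sumr_ge0.
  rewrite in_itv /= h1 /= /M (bigD1 i) //= -h2 (bigD1 j) //= -addrA lerDl.
  by rewrite addr_ge0 // sumr_ge0.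
have costc : continuous (fun v : 'rV[R]_(m.+1 * n.+1) =>
    transport_cost c (vec_mx v)).
  apply: (@sumc) => i; apply: (@sumc) => j v.
  by apply: continuousM; [exact: cont | exact: cst_continuous].
have [v vB vmin] := EVT_min_rV B0 Bcompact (continuous_subspaceT costc).
rewrite inE in vB; exists (vec_mx v) => //; apply/eqP; rewrite eq_le.
apply/andP; split.
  apply: lb_le_inf; first by case: A0 => z Az; exists (transport_cost c z), z.
  move=> _ [z Az <-]; rewrite -[z in leRHS]mxvecK; apply: vmin.
  by rewrite inE /B /= mxvecK.
apply: ge_inf; last by exists (vec_mx v).
exists (transport_cost c (vec_mx v)) => _ [z Az <-].
by rewrite -[z in leRHS]mxvecK; apply: vmin; rewrite inE /B /= mxvecK.
Qed.

End OptimalTransport.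

Section MannSequences.
Context {R : realType}.
Implicit Types (X : normedModType R) (pi : nat -> nat -> R).

Definition diam X (C : set X) : R := sup [set `|u.1 - u.2| | u in C `*` C].

Definition unit_convex_domain X (C : set X) : Prop :=
  [/\ convex_set C, bounded_set C & diam C = 1].

(* A map C -> C is a total map that sends C to itself; its values outside C
   are irrelevant. *)
Definition nonexpansive_on X (C : set X) (T : X -> X) : Prop :=
  set_fun C C T /\ forall x y, C x -> C y -> `|T x - T y| <= `|x - y|.

(* T x^{i-1}, with the convention T x^{-1} = y0. *)
Definition Tprev X (T : X -> X) (y0 : X) (x : nat -> X) (i : nat) : X :=
  if i is k.+1 then T (x k) else y0.

Definition mann_sequence pi X (T : X -> X) (x0 y0 : X) (x : nat -> X) : Prop :=
  x 0%N = x0 /\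
  forall n, (1 <= n)%N -> x n = \sum_(i < n.+1) pi n i *: Tprev T y0 x i.

Definition mann_instance pi X (C : set X) (T : X -> X) (x0 y0 : X)
    (x : nat -> X) : Prop :=
  [/\ unit_convex_domain C, nonexpansive_on C T, C x0 /\ C y0 &
      mann_sequence pi T x0 y0 x].

(* The worst-case residual; an extended real, so that the supremum is
   meaningful without a proof that the residuals are bounded.
   The initial points satisfy x0 = y0, which is what the recursion says at
   n = 0, where pi^0_0 = 1: x^0 = T x^{-1}. The bounds d and R come from the
   recursion at all n >= 0, and they fail for x0 != y0: if C = [0, 1],
   T x = 1 - x, x0 = 0, y0 = 1 and pi^1 = (1/2, 1/2), then x^1 = 1 and
   |x^1 - T x^1| = 1 > 3/4 = R_1. *)
Definition Psi pi (n : nat) : \bar R :=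
  ereal_sup [set e | exists (X : normedModType R) (C : set X) (T : X -> X)
    (x0 y0 : X) (x : nat -> X),
    [/\ mann_instance pi C T x0 y0 x, x0 = y0 &
        e = (`|x n - T (x n)|)%:E]].

End MannSequences.

(* Main.v *)
From HB Require Import structures.
Require Import Defs.
From mathcomp Require Import ring lra.

(** Write [d] for the recursive bounds, with indices shifted by one so that the
    fictitious index -1 becomes 0, and [y i] for the image T x^{i-1}, so that
    [x n] is the barycenter of [y 0], ..., [y n] with weights [pi n].

    Upper bounds. A transport plan z between [pi m] and [pi n] writes
    [x m - x n] as the sum of the z_ij (y i - y j). Since T is non-expansive,
    |y i - y j| is at most |x^{i-1} - x^{j-1}|, or the diameter 1 when exactly
    one of the indices is 0, and induction gives |x m - x n| <= d m.+1 n.+1.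
    The residual is treated in the same way, because [T (x n)] is [y n.+1]
    ([mann_residual_le]).

    Attaining them. The key fact is that [d] is a pseudometric bounded by 1
    ([unit_pseudometric_dS]). Then optimal transport has a Kantorovich dual
    ([strong_duality]): the optimal cost is the largest value of
    sum_i p_i u_i - sum_j q_j u_j over the functions u that are 1-Lipschitz for
    [d] and take values in [0, 1]. Duality also proves the pseudometric
    property: each level of [d] is a supremum of differences of linear forms in
    the marginals, from which symmetry and the triangle inequality are immediate.

    Now let y i be evaluation at i, as a function on the set of potentials u,
    in the space of bounded functions with the sup norm. Then
    |y i - y j| <= d i j, and the coordinate given by an optimal dual potential
    turns |x m - x n| <= d m.+1 n.+1 into an equality ([extremal_dist]); the
    coordinate u = d (., n.+1) does the same for the residual
    ([extremal_residual_ge]). It remains to find a non-expansive T that sends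
    each x n to y n.+1. On the sequence this prescription is non-expansive, since
    |y m.+1 - y n.+1| <= d m.+1 n.+1 = |x m - x n|, and it extends to the whole
    cube of [0, 1]-valued functions by McShane's formula in each coordinate
    ([nonexpansive_extension]). *)

Set Implicit Arguments.
Unset Strict Implicit.
Unset Printing Implicit Defensive.

Local Open Scope classical_set_scope.
Local Open Scope ring_scope.

(** * Transport duality for a bounded pseudometric cost *)

Section Duality.
Context {R : realType}.
Implicit Types (p q u : nat -> R) (c : nat -> nat -> R).

Definition unit_pseudometric c : Prop :=
  [/\ forall i, c i i = 0, forall i j, c i j = c j i,
      forall i j k, c i k <= c i j + c j k & forall i j, c i j <= 1].

Lemma unit_pseudometric_ge0 c i j : unit_pseudometric c -> 0 <= c i j.
Proof. by case=> c0 cC ctri _; have := ctri i j i; rewrite c0 (cC j); lra. Qed.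

(** The dual potentials. Restricting their values to [0, 1] loses nothing when
    the cost is at most 1, and makes every potential a coordinate of the unit
    cube in which the extremal sequence lives. *)
Definition unit_lipschitz c u : Prop :=
  (forall i j, u i - u j <= c i j) /\ (forall i, 0 <= u i <= 1).

Section Plans.
Variables (m n : nat).
Implicit Types (A B D z : 'M[R]_(m.+1, n.+1)) (e : 'I_m.+1 * 'I_n.+1).

Lemma transport_costD c A B :
  transport_cost c (A + B) = transport_cost c A + transport_cost c B.
Proof.
rewrite -big_split; apply: eq_bigr => i _; rewrite -big_split.
by apply: eq_bigr => j _; rewrite mxE mulrDl.
Qed.

Lemma transport_costZ c a A : transport_cost c (a *: A) = a * transport_cost c A.
Proof.
rewrite mulr_sumr; apply: eq_bigr => i _; rewrite mulr_sumr.
by apply: eq_bigr => j _; rewrite mxE mulrA.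
Qed.

Lemma transport_cost0 c : transport_cost c (0 : 'M[R]_(m.+1, n.+1)) = 0.
Proof. by apply: big1 => i _; apply: big1 => j _; rewrite mxE mul0r. Qed.

Lemma transport_costB c A B :
  transport_cost c (A - B) = transport_cost c A - transport_cost c B.
Proof. by rewrite -scaleN1r transport_costD transport_costZ mulN1r. Qed.

Lemma sum_delta_row i0 j0 i :
  \sum_(j < n.+1) (delta_mx i0 j0 : 'M[R]_(m.+1, n.+1)) i j = (i == i0)%:R.
Proof.
rewrite (bigD1 j0) //= big1 ?addr0; first by rewrite mxE eqxx andbT.
by move=> j /negPf jj0; rewrite mxE jj0 andbF.
Qed.

Lemma sum_delta_col i0 j0 j :
  \sum_(i < m.+1) (delta_mx i0 j0 : 'M[R]_(m.+1, n.+1)) i j = (j == j0)%:R.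
Proof.
rewrite (bigD1 (i0 : 'I_m.+1)) //= big1 ?addr0; first by rewrite mxE !eqxx.
by move=> i /negPf ii0; rewrite mxE ii0.
Qed.

Lemma transport_cost_delta c i0 j0 :
  transport_cost c (delta_mx i0 j0 : 'M[R]_(m.+1, n.+1)) = c i0 j0.
Proof.
rewrite /transport_cost (bigD1 i0) //= [X in _ + X]big1 ?addr0 => [|i /negPf ii0].
  rewrite (bigD1 j0) //= big1 ?addr0 => [|j /negPf jj0].
    by rewrite mxE !eqxx mul1r.
  by rewrite mxE jj0 andbF mul0r.
by apply: big1 => j _; rewrite mxE ii0 mul0r.
Qed.

Lemma min_transport_le p q c z : (forall i j, 0 <= c i j) ->
  transport_plans p q z -> min_transport m n p q c <= transport_cost c z.
Proof.
move=> c_ge0 pz; apply: ge_inf; last by exists z.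
exists 0 => _ [w [w_ge0 _ _] <-].
by apply: sumr_ge0 => i _; apply: sumr_ge0 => j _; exact: mulr_ge0.
Qed.

Lemma product_plan p q : (forall i, 0 <= p i) -> (forall j, 0 <= q j) ->
  \sum_(i < m.+1) p i = 1 -> \sum_(j < n.+1) q j = 1 ->
  @transport_plans _ m n p q !=set0.
Proof.
move=> p_ge0 q_ge0 p1 q1; exists (\matrix_(i, j) (p i * q j)); split.
- by move=> i j; rewrite mxE mulr_ge0.
- by move=> i; under eq_bigr do rewrite mxE; rewrite -mulr_sumr q1 mulr1.
- by move=> j; under eq_bigr do rewrite mxE; rewrite -mulr_suml p1 mul1r.
Qed.

(** The coefficients of a difference of two barycenters may be spread over any
    plan; both the norm estimate and the dual value of a plan come from this
    identity. *)
Lemma plan_barycenter (V : lmodType R) (y : nat -> V) p q z :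
  transport_plans p q z ->
  \sum_(i < m.+1) p i *: y i - \sum_(j < n.+1) q j *: y j =
  \sum_(i < m.+1) \sum_(j < n.+1) z i j *: (y i - y j).
Proof.
case=> _ zp zq.
under [RHS]eq_bigr do (under eq_bigr do rewrite scalerBr; rewrite sumrB).
rewrite sumrB [X in _ = _ - X]exchange_big /=.
by congr (_ - _); apply: eq_bigr => k _; rewrite -?zp -?zq scaler_suml.
Qed.

Lemma plan_potential p q u z : transport_plans p q z ->
  \sum_(i < m.+1) p i * u i - \sum_(j < n.+1) q j * u j =
  transport_cost (fun i j => u i - u j) z.
Proof. exact: (@plan_barycenter R^o). Qed.

Lemma plan_ler_norm (X : normedModType R) (y : nat -> X) p q c z :
  transport_plans p q z ->
  (forall (i : 'I_m.+1) (j : 'I_n.+1), `|y i - y j| <= c i j) ->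
  `|\sum_(i < m.+1) p i *: y i - \sum_(j < n.+1) q j *: y j| <=
  transport_cost c z.
Proof.
move=> pz yc; rewrite (plan_barycenter _ pz).
apply: le_trans (ler_norm_sum _ _ _) _; apply: ler_sum => i _.
apply: le_trans (ler_norm_sum _ _ _) _; apply: ler_sum => j _.
by case: pz => z_ge0 _ _; rewrite normrZ ger0_norm // ler_wpM2l.
Qed.

(** First-order optimality: [z + a *: D] is still a plan for small [a > 0], as
    [D] can be negative only where [z] has some mass to give up. *)
Lemma optimal_plan_variation p q c z D : (forall i j, 0 <= c i j) ->
  transport_plans p q z -> transport_cost c z = min_transport m n p q c ->
  (forall i, \sum_(j < n.+1) D i j = 0) ->
  (forall j, \sum_(i < m.+1) D i j = 0) ->
  (forall i j, ~~ (0 < z i j) -> 0 <= D i j) ->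
  0 <= transport_cost c D.
Proof.
move=> c_ge0 [z_ge0 zp zq] zmin Drow Dcol Dz.
have [a a_gt0 aD] : exists2 a, 0 < a & forall i j, 0 <= z i j + a * D i j.
  have : \forall a \near 0^'+, forall (e : 'I_m.+1 * 'I_n.+1),
      0 <= z e.1 e.2 + a * D e.1 e.2.
    apply: filter_forall => -[i j] /=; case: (boolP (0 < z i j)) => zij; last first.
      near=> a; have a_gt0 : 0 < a by [].
      by rewrite addr_ge0 ?z_ge0 // mulr_ge0 ?Dz // ltW.
    near=> a.
    have a_gt0 : 0 < a by [].
    have ale : a <= z i j / (1 + `|D i j|).
      by near: a; apply: nbhs_right_le; rewrite divr_gt0 // ltr_pwDl.
    move: ale; rewrite ler_pdivlMr ?ltr_pwDl // => ale.
    have := ler_norm (- D i j); rewrite normrN => h.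
    have := ler_wpM2l (ltW a_gt0) h; nra.
  have gt0 : \forall a \near (0:R)^'+, 0 < a by exact: nbhs_right_gt.
  move=> H; have [a [a0 /= aD]] := @filter_ex _ _ _ _ (filterI gt0 H).
  by exists a => // i j; exact: (aD (i, j)).
have pa : transport_plans p q (z + a *: D).
  split=> [i j|i|j]; first by rewrite !mxE.
  - under eq_bigr do rewrite !mxE.
    by rewrite big_split /= -mulr_sumr Drow mulr0 addr0.
  - under eq_bigr do rewrite !mxE.
    by rewrite big_split /= -mulr_sumr Dcol mulr0 addr0.
have := min_transport_le c_ge0 pa.
by rewrite -zmin transport_costD transport_costZ lerDl pmulr_rge0.
Unshelve. all: by end_near. Qed.

(** Ruschendorf's chains of pairs. The chain is listed backwards, [e] being its
    last pair; consecutive pairs (i, j), (i', j') contribute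
    c i j' - c i' j', the change of cost when a unit of mass sent from i' to j'
    is taken from i instead, and the last source is finally sent to [x]. *)
Fixpoint chain_cost c e (s : seq ('I_m.+1 * 'I_n.+1)) (x : nat) : R :=
  (if s is e' :: s' then chain_cost c e' s' e.2 - c e.1 e.2 else 0) + c e.1 x.

Fixpoint chain_variation e (s : seq ('I_m.+1 * 'I_n.+1)) : 'M[R]_(m.+1, n.+1) :=
  if s is e' :: s' then
    chain_variation e' s' + (delta_mx e'.1 e.2 - delta_mx e.1 e.2)
  else 0.

Lemma chain_costE c e s x :
  chain_cost c e s x = transport_cost c (chain_variation e s) + c e.1 x.
Proof.
elim: s e x => [|e' s IH] e x /=.
  by rewrite transport_cost0.
rewrite IH transport_costD transport_costB !transport_cost_delta; ring.
Qed.

Lemma chain_variation_row e s i :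
  \sum_(j < n.+1) chain_variation e s i j =
  (i == (last e s).1)%:R - (i == e.1)%:R.
Proof.
elim: s e => [|e' s IH] e /=.
  by rewrite subrr; apply: big1 => j _; rewrite mxE.
under eq_bigr do rewrite mxE [X in _ + X]mxE [X in _ + (_ + X)]mxE.
rewrite big_split sumrB /= IH !sum_delta_row; ring.
Qed.

Lemma chain_variation_col e s j :
  \sum_(i < m.+1) chain_variation e s i j = 0.
Proof.
elim: s e => [|e' s IH] e /=; first by apply: big1 => i _; rewrite mxE.
under eq_bigr do rewrite mxE [X in _ + X]mxE [X in _ + (_ + X)]mxE.
by rewrite big_split sumrB /= IH !sum_delta_col subrr addr0.
Qed.

Lemma chain_variation_ge0 (S : pred ('I_m.+1 * 'I_n.+1)) e s i j :
  all S (e :: s) -> ~~ S (i, j) -> 0 <= chain_variation e s i j.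
Proof.
elim: s e => [|e' s IH] e; first by rewrite mxE.
move=> /andP[Se Ss] Sij /=; rewrite mxE addr_ge0 ?IH // !mxE.
have -> : (i == e.1) && (j == e.2) = false.
  by apply: contraNF Sij => /andP[/eqP-> /eqP->]; rewrite -surjective_pairing.
by rewrite subr0 ler0n.
Qed.

(** Cyclical monotonicity: closing a chain of support pairs up, by sending its
    last source to its first target, gives a variation with zero marginals, which
    cannot lower the cost of an optimal plan. *)
Lemma optimal_chain_ge p q c z e s : (forall i j, 0 <= c i j) ->
  transport_plans p q z -> transport_cost c z = min_transport m n p q c ->
  all (fun e => 0 < z e.1 e.2) (e :: s) ->
  c (last e s).1 (last e s).2 <= chain_cost c e s (last e s).2.
Proof.
move=> c_ge0 pz zmin zs; set l := last e s.
pose D := chain_variation e s + (delta_mx e.1 l.2 - delta_mx l.1 l.2).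
have : 0 <= transport_cost c D.
  apply: (optimal_plan_variation c_ge0 pz zmin).
  - move=> i; under eq_bigr do rewrite mxE [X in _ + X]mxE [X in _ + (_ + X)]mxE.
    rewrite big_split sumrB /= chain_variation_row !sum_delta_row -/l; ring.
  - move=> j; under eq_bigr do rewrite mxE [X in _ + X]mxE [X in _ + (_ + X)]mxE.
    rewrite big_split sumrB /= chain_variation_col !sum_delta_col; ring.
  - move=> i j zij; rewrite mxE addr_ge0 //.
      by apply: (chain_variation_ge0 zs).
    rewrite !mxE.
    have -> : (i == l.1) && (j == l.2) = false.
      apply: contraNF zij => /andP[/eqP-> /eqP->].
      by have /allP/(_ l) := zs; apply; exact: mem_last.
    by rewrite subr0 ler0n.
rewrite chain_costE transport_costD transport_costB !transport_cost_delta; lra.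
Qed.

(** The potential is minus the infimum, over the chains of support pairs, of the
    chain cost at [x]. It is 1-Lipschitz because the last link is
    [c _ x]; and it is tight on a support pair (i, j) because any chain
    evaluated at j can be prolonged by (i, j) and evaluated at i, which changes
    its cost by exactly - c i j. *)
Lemma kantorovich_potential p q c z : unit_pseudometric c ->
  \sum_(i < m.+1) p i = 1 ->
  transport_plans p q z -> transport_cost c z = min_transport m n p q c ->
  exists2 u, forall i j, u i - u j <= c i j &
    forall (i : 'I_m.+1) (j : 'I_n.+1), 0 < z i j -> c i j <= u i - u j.
Proof.
move=> cm p1 pz zmin; have c_ge0 i j := unit_pseudometric_ge0 i j cm.
have [c0 cC ctri c_le1] := cm.
pose S := [pred e : 'I_m.+1 * 'I_n.+1 | 0 < z e.1 e.2].
pose A x := [set chain_cost c es.1 es.2 x | es in [set es | all S (es.1 :: es.2)]].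
pose u x := inf (A x).
have [e0 Se0] : exists e, S e.
  apply: contrapT => /forallNP Sn; case: pz => z_ge0 zp _.
  move: p1; rewrite big1 => [/esym/eqP|i _]; first by rewrite oner_eq0.
  rewrite -zp; apply: big1 => j _; apply/eqP; rewrite eq_le z_ge0 andbT leNgt.
  exact/negP/(Sn (i, j)).
have A0 x : A x !=set0.
  by exists (chain_cost c e0 [::] x), (e0, [::]) => //=; rewrite andbT.
have Alb x : has_lbound (A x).
  (* Replacing the end x of the chain by its first target l.2 costs at most
     c x l.2 <= 1, and then cyclical monotonicity bounds the cost below. *)
  exists (-1) => _ [[e s] /= Ses <-].
  have := optimal_chain_ge c_ge0 pz zmin Ses; rewrite !chain_costE.
  set l := last e s.
  have := ctri e.1 x l.2; have := c_le1 x l.2; have := c_ge0 l.1 l.2; lra.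
have uP x e s : all S (e :: s) -> u x <= chain_cost c e s x.
  by move=> Ses; apply: ge_inf => //; exists (e, s).
exists (fun x => - u x) => [i j|i j zij]; rewrite (opprK (u j)) (addrC (- u i)).
  rewrite lerBlDr addrC -lerBlDr; apply: lb_le_inf => // _ [[e s] /= Ses <-].
  have := uP j _ _ Ses; rewrite !chain_costE.
  by have := ctri e.1 i j; lra.
rewrite lerBrDr; apply: lb_le_inf => // _ [[e s] /= Ses <-].
have := uP i (i, j) (e :: s); rewrite /= zij c0 => /(_ Ses); lra.
Qed.

Lemma weak_duality p q c u : @transport_plans _ m n p q !=set0 ->
  unit_lipschitz c u ->
  \sum_(i < m.+1) p i * u i - \sum_(j < n.+1) q j * u j <=
  min_transport m n p q c.
Proof.
move=> /(min_transport_attained c)[z pz <-] [uc _].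
rewrite (plan_potential _ pz); case: pz => z_ge0 _ _.
by apply: ler_sum => i _; apply: ler_sum => j _; rewrite ler_wpM2l.
Qed.

(** The potential of an optimal plan, translated so that its infimum is 0, since
    translations do not change the dual value when both masses are 1. *)
Lemma strong_duality p q c : unit_pseudometric c ->
  \sum_(i < m.+1) p i = 1 -> \sum_(j < n.+1) q j = 1 ->
  @transport_plans _ m n p q !=set0 ->
  exists2 u, unit_lipschitz c u &
    \sum_(i < m.+1) p i * u i - \sum_(j < n.+1) q j * u j =
    min_transport m n p q c.
Proof.
move=> cm p1 q1 /(min_transport_attained c)[z pz zmin].
have [v vc vz] := kantorovich_potential cm p1 pz zmin.
have [_ cC _ c_le1] := cm.
have v_lb x : lbound (range v) (v x - 1).
  by move=> _ [y _ <-]; have := vc x y; have := c_le1 x y; lra.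
have v_has : has_lbound (range v) by exists (v 0%N - 1).
pose a := inf (range v); pose u x := v x - a.
exists u.
  split=> [i j|i]; first by rewrite /u; have := vc i j; lra.
  rewrite /u subr_ge0 ge_inf //=; last by exists i.
  have : v i - 1 <= a by apply: lb_le_inf => //; exists (v 0%N), 0%N.
  lra.
rewrite (plan_potential u pz) -zmin; apply: eq_bigr => i _.
apply: eq_bigr => j _; case: pz => z_ge0 _ _.
have := z_ge0 i j; rewrite le_eqVlt => /predU1P[<-|zij]; first by rewrite !mul0r.
by congr (_ * _); apply/eqP; rewrite eq_le /u; have := vc i j; have := vz i j zij; lra.
Qed.

End Plans.
End Duality.

(** * Bounded functions with the sup norm *)

Section BoundedFunctions.
Context {R : realType} (Q : Type).

Definition bounded_functions : {pred Q -> R} :=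
  fun f => `[< exists M, forall t, `|f t| <= M >].

Lemma bounded_functions_submod_closed : submod_closed bounded_functions.
Proof.
split=> [|a f g /asboolP[M fM] /asboolP[N gN]]; apply/asboolP.
  by exists 0 => t; rewrite normr0.
exists (`|a| * M + N) => t; apply: le_trans (ler_normD _ _) _.
by rewrite lerD // normrM ler_wpM2l.
Qed.

HB.instance Definition _ :=
  GRing.isSubmodClosed.Build _ _ bounded_functions bounded_functions_submod_closed.

Record bfun := Bfun { bfun_val :> Q -> R; _ : bfun_val \in bounded_functions }.

HB.instance Definition _ := [isSub for bfun_val].
HB.instance Definition _ := [Choice of bfun by <:].
HB.instance Definition _ := [SubChoice_isSubLmodule of bfun by <:].

Implicit Types f g : bfun.

Definition sup_norm f : R := sup (range (fun t => `|f t|)).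

Lemma ler_sup_norm f t : `|f t| <= sup_norm f.
Proof.
apply: ub_le_sup; last by exists t.
by case: f => f /= /asboolP[M fM]; exists M => _ [s _ <-].
Qed.

Lemma sup_norm_ler f M : 0 <= M -> (forall t, `|f t| <= M) -> sup_norm f <= M.
Proof.
move=> M_ge0 fM; have [[_ [t _ _]]|/nonemptyPn E] := pselect (range (fun t => `|f t|) !=set0).
  by apply: ge_sup => [|_ [s _ <-]]; [exists `|f t|, t|exact: fM].
by rewrite /sup_norm E sup0.
Qed.

Lemma sup_norm_ge0 f : 0 <= sup_norm f.
Proof.
have [[_ [t _ _]]|/nonemptyPn E] := pselect (range (fun t => `|f t|) !=set0).
  exact: le_trans (ler_sup_norm f t).
by rewrite /sup_norm E sup0.
Qed.

Lemma sup_normD f g : sup_norm (f + g) <= sup_norm f + sup_norm g.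
Proof.
apply: sup_norm_ler => [|t]; first by rewrite addr_ge0 ?sup_norm_ge0.
by apply: le_trans (ler_normD _ _) _; rewrite lerD ?ler_sup_norm.
Qed.

Lemma sup_normZ_le a f : sup_norm (a *: f) <= `|a| * sup_norm f.
Proof.
apply: sup_norm_ler => [|t]; first by rewrite mulr_ge0 ?sup_norm_ge0.
by rewrite [leLHS]normrM ler_wpM2l ?ler_sup_norm.
Qed.

Lemma sup_normZ a f : sup_norm (a *: f) = `|a| * sup_norm f.
Proof.
apply/eqP; rewrite eq_le sup_normZ_le /=.
have [->|a0] := eqVneq a 0; first by rewrite normr0 mul0r sup_norm_ge0.
rewrite -ler_pdivlMl ?normr_gt0 // -normfV.
by have := sup_normZ_le a^-1 (a *: f); rewrite scalerA mulVf // scale1r.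
Qed.

Lemma sup_norm_eq0 f : sup_norm f = 0 -> f = 0.
Proof.
move=> f0; apply/val_inj/funext => t; apply/eqP.
by rewrite -normr_le0 -f0; exact: ler_sup_norm.
Qed.

HB.instance Definition _ :=
  Lmodule_isNormed.Build R bfun sup_normD sup_normZ sup_norm_eq0.

Lemma bfun_ler_norm f t : `|f t| <= `|f|. Proof. exact: ler_sup_norm. Qed.

Lemma bfun_norm_ler f M : 0 <= M -> (forall t, `|f t| <= M) -> `|f| <= M.
Proof. exact: sup_norm_ler. Qed.

Lemma bfunBE f g t : (f - g) t = f t - g t. Proof. by []. Qed.
Lemma bfunZE a f t : (a *: f) t = a * f t. Proof. by []. Qed.

Lemma bfun_sumE n (F : 'I_n -> bfun) t : (\sum_i F i) t = \sum_i F i t.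
Proof. exact: (big_morph (fun f : bfun => f t)). Qed.

Definition unit_cube : set bfun := [set f | forall t, 0 <= f t <= 1].

Lemma unit_cube_bounded (h : Q -> R) : (forall t, 0 <= h t <= 1) ->
  h \in bounded_functions.
Proof.
move=> h01; apply/asboolP; exists 1 => t.
by case/andP: (h01 t) => h0 h1; rewrite ger0_norm.
Qed.

Lemma unit_cube_domain (q : Q) : unit_convex_domain unit_cube.
Proof.
have dist_le1 f g : unit_cube f -> unit_cube g -> `|f - g| <= 1.
  move=> Cf Cg; apply: bfun_norm_ler => // t; rewrite bfunBE ler_norml.
  by have := Cf t; have := Cg t; lra.
have one_bnd : (fun _ : Q => 1) \in bounded_functions.
  by apply: unit_cube_bounded => t; rewrite ler01 lexx.
have C0 : unit_cube 0 by move=> t; rewrite lexx ler01.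
have C1 : unit_cube (Bfun one_bnd) by move=> t; rewrite ler01 lexx.
split.
- move=> f g l; rewrite !inE => Cf Cg t.
  change (0 <= l%:num * f t + (1 - l%:num) * g t <= 1).
  have l0 : 0 <= l%:num by [].
  have l1 : l%:num <= 1 by [].
  have := Cf t; have := Cg t; nra.
- exists 1; split=> // M /ltW M1 f /= Cf.
  by apply: le_trans M1; rewrite -[f]subr0; exact: dist_le1.
- apply/eqP; rewrite eq_le; apply/andP; split.
    apply: ge_sup; first by exists `|0 - 0 : bfun|, (0, 0).
    by move=> _ [[f g] /= [Cf Cg] <-]; exact: dist_le1.
  apply: (@le_trans _ _ `|Bfun one_bnd - 0|).
    have := bfun_ler_norm (Bfun one_bnd - 0) q.
    by rewrite bfunBE /= subr0 normr1.
  apply: ub_le_sup; last by exists (Bfun one_bnd, 0).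
  by exists 1 => _ [[f g] /= [Cf Cg] <-]; exact: dist_le1.
Qed.

(** McShane's formula [inf_i (b i t + |x - a i|)] extends each coordinate, and
    truncating it at 1 keeps the extension inside the cube without
    increasing its Lipschitz constant. *)
Lemma nonexpansive_extension (I : pointedType) (a b : I -> bfun) :
  (forall i, unit_cube (b i)) ->
  (forall i j, `|b i - b j| <= `|a i - a j|) ->
  exists2 T, nonexpansive_on unit_cube T & forall i, T (a i) = b i.
Proof.
move=> Cb ab.
pose A (x : bfun) t : set R := range (fun i => b i t + `|x - a i|).
have b01 i t : 0 <= b i t <= 1 by exact: Cb.
have A0 x t : A x t !=set0 by exists (b point t + `|x - a point|), point.
have Alb0 x t : lbound (A x t) 0.
  by move=> _ [i _ <-]; rewrite addr_ge0 //; case/andP: (b01 i t).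
have Alb x t : has_lbound (A x t) by exists 0.
pose h x t := Num.min 1 (inf (A x t)).
have h01 x t : 0 <= h x t <= 1.
  by rewrite /h le_min ler01 ge_min lexx lb_le_inf.
pose T x := Bfun (unit_cube_bounded (h01 x)).
have infT x y t : inf (A x t) - `|x - y| <= inf (A y t).
  apply: lb_le_inf => // _ [i _ <-]; rewrite lerBlDr.
  apply: (@le_trans _ _ (b i t + `|x - a i|)); first by apply: ge_inf => //; exists i.
  by rewrite -addrA lerD2l addrC ler_distD.
have min1 (r u v : R) : 0 <= r -> u - r <= v -> Num.min 1 u - Num.min 1 v <= r.
  by case: (leP 1 u) => ?; case: (leP 1 v) => ? *; lra.
have hT x y t : h x t - h y t <= `|x - y| by exact: min1.
exists T; first split=> [x _ t|x y _ _]; first exact: h01.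
  apply: bfun_norm_ler => // t; change (`|h x t - h y t| <= `|x - y|).
  rewrite ler_norml; apply/andP; split; last exact: hT.
  by rewrite -lerN2 opprK opprB distrC; exact: hT.
move=> k; apply/val_inj/funext => t.
suff E : inf (A (a k) t) = b k t.
  by rewrite /= /h E; apply/min_idPr; case/andP: (b01 k t).
apply/eqP; rewrite eq_le; apply/andP; split.
  by apply: ge_inf => //; exists k => //; rewrite subrr normr0 addr0.
apply: lb_le_inf => // _ [i _ <-]; rewrite -lerBlDl.
apply: le_trans (ab k i); rewrite -bfunBE.
exact: le_trans (ler_norm _) (bfun_ler_norm _ _).
Qed.

End BoundedFunctions.

(** * The recursive bounds form a pseudometric *)

Section BoundIsMetric.
Context {R : realType}.
Implicit Types (c : nat -> nat -> R).

(** Triangle inequality by duality: the potential u that is optimal between m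
    and l is admissible between m and n and between n and l, and its dual values
    add up. Likewise 1 - u is admissible for the
    transport in the opposite direction, which gives symmetry. *)
Lemma unit_pseudometric_min_transport c (pi : nat -> nat -> R) :
  (forall n i, 0 <= pi n i) -> (forall n, \sum_(i < n.+1) pi n i = 1) ->
  unit_pseudometric c ->
  unit_pseudometric (fun m n => min_transport m n (pi m) (pi n) c).
Proof.
move=> pi_ge0 pi_sum1 cm; pose W m n := min_transport m n (pi m) (pi n) c.
have plan m n : @transport_plans _ m n (pi m) (pi n) !=set0.
  exact: product_plan.
have strong m n := strong_duality cm (pi_sum1 m) (pi_sum1 n) (plan m n).
have weak m n u := @weak_duality _ m n _ _ c u (plan m n).
have tri m n l : W m l <= W m n + W n l.
  rewrite {1}/W; have [u ulip <-] := strong m l.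
  by have := weak m n u ulip; have := weak n l u ulip; rewrite -/(W _ _) -/(W _ _); lra.
have diag m : W m m = 0 by rewrite /W; have [u _ <-] := strong m m; rewrite subrr.
have sym_le m n : W m n <= W n m.
  rewrite {1}/W; have [u [uc u01] <-] := strong m n.
  have := weak n m (fun i => 1 - u i); rewrite -/(W _ _).
  under eq_bigr do rewrite mulrBr mulr1.
  under [X in _ - X]eq_bigr do rewrite mulrBr mulr1.
  rewrite !sumrB !pi_sum1 => h; apply: le_trans (h _); first lra.
  have [_ cC _ _] := cm.
  by split=> [i j|i]; [rewrite cC; have := uc j i; lra|have := u01 i; lra].
split=> // [m n|m n].
  by apply/eqP; rewrite eq_le !sym_le.
have [u [_ u01] <-] := strong m n.
have le1 : \sum_(i < m.+1) pi m i * u i <= 1.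
  rewrite -(pi_sum1 m); apply: ler_sum => i _; rewrite ler_piMr //.
  by case/andP: (u01 i).
have ge0 : 0 <= \sum_(j < n.+1) pi n j * u j.
  by apply: sumr_ge0 => j _; rewrite mulr_ge0 //; case/andP: (u01 j).
lra.
Qed.

(** The index 0 stands for the fictitious index -1, at distance 1 from all the
    others. *)
Definition adjoin_point c (r s : nat) : R :=
  match r, s with
  | 0, 0 => 0
  | 0, _.+1 | _.+1, 0 => 1
  | m.+1, n.+1 => c m n
  end.

Lemma unit_pseudometric_adjoin c :
  unit_pseudometric c -> unit_pseudometric (adjoin_point c).
Proof.
move=> cm; have c_ge0 i j := unit_pseudometric_ge0 i j cm.
case: cm => c0 cC ctri c_le1.
split=> [[|i]|[|i] [|j]|[|i] [|j] [|k]|[|i] [|j]] //=; try lra.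
- by have := c_ge0 j k; lra.
- by have := c_le1 i k; lra.
- by have := c_ge0 i j; lra.
Qed.

Lemma unit_pseudometric_comp c (f : nat -> nat) :
  unit_pseudometric c -> unit_pseudometric (fun i j => c (f i) (f j)).
Proof. by case=> c0 cC ctri c_le1; split. Qed.

(** The recursion defines [d] at level N + 1 as the transport distance for [d] at
    level N. Truncating the indices at N makes each level a pseudometric on all
    the naturals, to which duality applies. *)
Lemma unit_pseudometric_dS (pi : nat -> nat -> R) :
  (forall n i, 0 <= pi n i) -> (forall n, \sum_(i < n.+1) pi n i = 1) ->
  unit_pseudometric (dS pi).
Proof.
move=> pi_ge0 pi_sum1.
have trunc N : unit_pseudometric (fun i j => dS pi (minn i N) (minn j N)).
  elim: N => [|N IH].
    by split=> *; rewrite !minn0 /dS /= ?addr0 ?ler01.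
  have := unit_pseudometric_adjoin (unit_pseudometric_comp (fun i => minn i N)
    (unit_pseudometric_min_transport pi_ge0 pi_sum1 IH)).
  congr unit_pseudometric; apply/funext => r; apply/funext => s.
  case: r s => [|m] [|n]; rewrite ?min0n ?minnSS //=.
  rewrite dS_SS; apply: eq_min_transport => i j im jn.
  congr dS; apply/minn_idPl; [apply: leq_trans im _|apply: leq_trans jn _];
    exact: geq_minr.
split=> [i|i j|i j k|i j].
- by case: (trunc i) => /(_ i); rewrite minnn.
- case: (trunc (maxn i j)) => _ /(_ i j).
  by rewrite !(minn_idPl _) ?leq_maxl ?leq_maxr.
- case: (trunc (maxn i (maxn j k))) => _ _ /(_ i j k) + _.
  by rewrite !(minn_idPl _) // !leq_max leqnn ?orbT.
- case: (trunc (maxn i j)) => _ _ _ /(_ i j).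
  by rewrite !(minn_idPl _) ?leq_maxl ?leq_maxr.
Qed.

End BoundIsMetric.

(** * Upper bounds for every Mann sequence *)

Section UpperBounds.
Context {R : realType} (X : normedModType R).
Implicit Types (C : set X) (T : X -> X).

Lemma convex_set_sum C (w : nat -> R) (y : nat -> X) n : convex_set C ->
  (forall i, 0 <= w i) -> (forall i, (i <= n)%N -> C (y i)) ->
  \sum_(i < n.+1) w i = 1 -> C (\sum_(i < n.+1) w i *: y i).
Proof.
move=> cC w_ge0 Cy w1.
(* Partial sums of the weights may vanish, hence an induction on the
   unnormalised sum. *)
suff [z Cz ->] : exists2 z, C z &
    \sum_(i < n.+1) w i *: y i = (\sum_(i < n.+1) w i) *: z.
  by rewrite w1 scale1r.
elim: n Cy {w1} => [|n IH] Cy; first by exists (y 0%N); rewrite ?big_ord1 //; exact: Cy.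
have [i le_in|z Cz zE] := IH; first by apply: Cy; exact: leqW.
rewrite !(big_ord_recr n.+1) /= zE.
set s := \sum_(i < n.+1) w i; have s_ge0 : 0 <= s by exact: sumr_ge0.
have := w_ge0 n.+1; set v := w n.+1 => v_ge0.
have [sv0|sv0] := eqVneq (s + v) 0.
  have -> : s = 0 by apply/eqP; rewrite eq_le s_ge0 andbT -sv0 lerDl.
  have -> : v = 0 by apply/eqP; rewrite eq_le v_ge0 andbT -sv0 lerDr.
  by exists z => //; rewrite addr0 !scale0r addr0.
have sv_gt0 : 0 < s + v by rewrite lt_neqAle eq_sym sv0 addr_ge0.
have l_ge0 : 0 <= s / (s + v) by rewrite divr_ge0 // ltW.
have l_le1 : s / (s + v) <= 1 by rewrite ler_pdivrMr // mul1r lerDl.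
exists (s / (s + v) *: z + (1 - s / (s + v)) *: y n.+1).
  apply/set_mem; apply: (cC z (y n.+1) (Itv01 l_ge0 l_le1)); rewrite inE //.
  exact: Cy.
rewrite scalerDr !scalerA; congr (_ *: _ + _ *: _); field => //.
Qed.

Lemma ler_diam C u v : bounded_set C -> C u -> C v -> `|u - v| <= diam C.
Proof.
move=> [M [_ /(_ (M + 1))]]; rewrite ltrDl ltr01 => /(_ isT) CM Cu Cv.
apply: ub_le_sup; last by exists (u, v).
exists (M + 1 + (M + 1)) => _ [[a b] [Ca Cb] <-].
by apply: le_trans (ler_normB _ _) _; rewrite lerD // CM.
Qed.

Section Instance.
Variables (pi : nat -> nat -> R) (C : set X) (T : X -> X) (x0 : X).
Variable x : nat -> X.
Hypotheses (pi_ge0 : forall n i, 0 <= pi n i).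
Hypotheses (pi_sum1 : forall n, \sum_(i < n.+1) pi n i = 1).
Hypothesis mann : mann_instance pi C T x0 x0 x.

Let y := Tprev T x0 x.

(** The recursion, imposed for n >= 1, also holds at n = 0 because both initial
    points are equal and pi^0_0 = 1. *)
Lemma mann_barycenter n : x n = \sum_(i < n.+1) pi n i *: y i.
Proof.
have [_ _ _ [xE0 xE]] := mann; case: n => [|n]; last exact: xE.
by have := pi_sum1 0; rewrite !big_ord1 /= => ->; rewrite scale1r.
Qed.

Lemma mann_in_domain n : C (x n).
Proof.
have [[cC _ _] [TC _] [Cx0 _] _] := mann.
elim/ltn_ind: n => n IH; rewrite mann_barycenter.
apply: (convex_set_sum cC) => // -[|i] ik //; exact/TC/IH.
Qed.

Lemma mann_image_in_domain i : C (y i).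
Proof.
have [_ [TC _] [Cx0 _] _] := mann.
case: i => [|i] //; exact/TC/mann_in_domain.
Qed.

Lemma mann_dist_step m n :
  (forall i j, (i <= m)%N -> `|y i - y j| <= dS pi i j) ->
  `|x m - x n| <= dS pi m.+1 n.+1.
Proof.
move=> yd; have [|z pz zmin] := @min_transport_attained _ m n (pi m) (pi n) (dS pi).
  exact: product_plan.
rewrite !mann_barycenter dS_SS -zmin; apply: plan_ler_norm pz _ => i j.
by apply: yd; case: i.
Qed.

Lemma mann_image_dist_le i j : `|y i - y j| <= dS pi i j.
Proof.
have [[_ bC dC] [_ T1] _ _] := mann.
elim/ltn_ind: i j => -[|m] IH [|n]; rewrite ?subrr ?normr0 //.
- by rewrite -[leRHS]dC; apply: ler_diam => //; exact: mann_image_in_domain.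
- by rewrite -[leRHS]dC; apply: ler_diam => //; exact: mann_image_in_domain.
apply: le_trans (T1 _ _ (mann_in_domain m) (mann_in_domain n)) _.
by apply: mann_dist_step => i j im; exact: IH.
Qed.

Lemma mann_residual_le n : `|x n - T (x n)| <= Rbound pi n.
Proof.
have -> : x n - T (x n) = \sum_(i < n.+1) pi n i *: (y i - y n.+1).
  under eq_bigr do rewrite scalerBr.
  by rewrite sumrB -scaler_suml pi_sum1 scale1r -mann_barycenter.
apply: le_trans (ler_norm_sum _ _ _) _; apply: ler_sum => i _.
by rewrite normrZ ger0_norm // ler_wpM2l // mann_image_dist_le.
Qed.

End Instance.
End UpperBounds.

(** * The extremal Mann sequence *)

Section Extremal.
Context {R : realType}.
Variable (pi : nat -> nat -> R).
Hypotheses (pi_ge0 : forall n i, 0 <= pi n i).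
Hypotheses (pi_sum1 : forall n, \sum_(i < n.+1) pi n i = 1).

Local Notation d := (dS pi).
Local Notation E := (bfun (R := R) (nat -> R)).

(** Indexing by all functions [u], with the value 0 off the potentials, avoids a
    subtype of coordinates. *)
Definition potential_value i (u : nat -> R) : R :=
  if `[< unit_lipschitz d u >] then u i else 0.

Lemma potential_value01 i u : 0 <= potential_value i u <= 1.
Proof.
rewrite /potential_value; case: asboolP => [[_ u01]//|_].
by rewrite lexx ler01.
Qed.

Definition evaluation i : E := Bfun (unit_cube_bounded (potential_value01 i)).

Lemma evaluation_lipschitz i u : unit_lipschitz d u -> evaluation i u = u i.
Proof. by move=> ulip; rewrite /= /potential_value asboolT. Qed.

Lemma evaluation_in_cube i : unit_cube (evaluation i).
Proof. exact: potential_value01. Qed.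

Lemma evaluation_dist_le i j : `|evaluation i - evaluation j| <= d i j.
Proof.
have dm := unit_pseudometric_dS pi_ge0 pi_sum1.
have d_ge0 := unit_pseudometric_ge0 i j dm; have [_ dC _ _] := dm.
apply: bfun_norm_ler => // u.
rewrite bfunBE /= /potential_value; case: asboolP => [[uc _]|_].
  rewrite ler_norml uc andbT -lerN2 opprK opprB dC; exact: uc.
by rewrite subrr normr0.
Qed.

Definition extremal_sequence n : E := \sum_(i < n.+1) pi n i *: evaluation i.

Lemma extremal_sequenceE n u : unit_lipschitz d u ->
  extremal_sequence n u = \sum_(i < n.+1) pi n i * u i.
Proof.
move=> ulip; rewrite bfun_sumE; apply: eq_bigr => i _.
by rewrite bfunZE evaluation_lipschitz.
Qed.

(** The upper bound is carried by an optimal plan, the lower bound by the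
    coordinate of an optimal dual potential. *)
Lemma extremal_dist m n :
  `|extremal_sequence m - extremal_sequence n| = dbound pi m n.
Proof.
have dm := unit_pseudometric_dS pi_ge0 pi_sum1.
have plan : @transport_plans _ m n (pi m) (pi n) !=set0 by exact: product_plan.
apply/eqP; rewrite eq_le /dbound dS_SS; apply/andP; split.
  have [z pz <-] := min_transport_attained d plan.
  by apply: plan_ler_norm pz _ => i j; exact: evaluation_dist_le.
have [u ulip <-] := strong_duality dm (pi_sum1 m) (pi_sum1 n) plan.
apply: le_trans (bfun_ler_norm _ u); apply: le_trans (ler_norm _).
by rewrite bfunBE !extremal_sequenceE.
Qed.

Lemma unit_lipschitz_dist k : unit_lipschitz d (fun i => d i k).
Proof.
have dm := unit_pseudometric_dS pi_ge0 pi_sum1; have [_ _ dtri d_le1] := dm.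
split=> [i j|i]; first by rewrite lerBlDr.
by rewrite d_le1 (unit_pseudometric_ge0 _ _ dm).
Qed.

(** At the coordinate u = d (., n.+1) every difference u i - u n.+1 equals
    d i n.+1, so all the terms of the residual are attained at once. *)
Lemma extremal_residual_ge n :
  Rbound pi n <= `|extremal_sequence n - evaluation n.+1|.
Proof.
have [d0 _ _ _] := unit_pseudometric_dS pi_ge0 pi_sum1.
have ulip := unit_lipschitz_dist n.+1.
apply: le_trans (bfun_ler_norm _ (fun i => d i n.+1)).
apply: le_trans (ler_norm _).
by rewrite bfunBE extremal_sequenceE // evaluation_lipschitz // d0 subr0.
Qed.

Lemma extremal_instance : exists (C : set E) (T : E -> E) (x0 : E) (x : nat -> E),
  [/\ mann_instance pi C T x0 x0 x,
      forall m n, `|x m - x n| = dbound pi m n &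
      forall n, `|x n - T (x n)| = Rbound pi n].
Proof.
have [|T nT TE] := @nonexpansive_extension R (nat -> R) nat extremal_sequence
  (fun n => evaluation n.+1) (fun n => evaluation_in_cube n.+1).
  by move=> m n; rewrite extremal_dist; exact: evaluation_dist_le.
have inst : mann_instance pi (@unit_cube R (nat -> R)) T (evaluation 0) (evaluation 0)
    extremal_sequence.
  split=> //; first exact: (unit_cube_domain (fun=> 0)).
    by split; exact: evaluation_in_cube.
  split.
    by have := pi_sum1 0; rewrite /extremal_sequence !big_ord1 => ->; rewrite scale1r.
  by move=> n _; apply: eq_bigr => -[[|i] ?] _ //=; rewrite TE.
exists (@unit_cube R (nat -> R)), T, (evaluation 0), extremal_sequence; split=> //.
  exact: extremal_dist.
move=> n; apply/eqP; rewrite eq_le (mann_residual_le pi_ge0 pi_sum1 inst) /=.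
by rewrite TE extremal_residual_ge.
Qed.

End Extremal.

Theorem theorem2p1 (R : realType) (pi : nat -> nat -> R)
  (pi_ge0 : forall n i, 0 <= pi n i)
  (pi_sum1 : forall n, \sum_(i < n.+1) pi n i = 1)
  (pi_support : forall n i, (n < i)%N -> pi n i = 0) :
  (exists (X : normedModType R) (C : set X) (T : X -> X) (x0 y0 : X)
      (x : nat -> X),
    [/\ mann_instance pi C T x0 y0 x, x0 = y0,
        forall m n, `|x m - x n| = dbound pi m n &
        forall n, `|x n - T (x n)| = Rbound pi n]) /\
  (forall n, Psi pi n = (Rbound pi n)%:E).
Proof.
have [C [T [x0 [x [inst xd xR]]]]] := extremal_instance pi_ge0 pi_sum1.
split; first by exists (bfun (R := R) (nat -> R)), C, T, x0, x0, x.
move=> n; apply/eqP; rewrite eq_le; apply/andP; split.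
  apply: ub_ereal_sup => _ [X [D [S [a [b [v [inst' ab ->]]]]]]].
  rewrite -ab in inst'.
  by rewrite lee_fin; exact: (mann_residual_le pi_ge0 pi_sum1 inst').
by apply: ereal_sup_ubound; exists (bfun (R := R) (nat -> R)), C, T, x0, x0, x; rewrite xR.
Qed.
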